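(* Let $R$ be a $d$-dimensional Noetherian local ring, with $d\geq1$. Then $R$ is Cohen-Macaulay if and only if there exists a binary numerical function $\delta_R$ such that for all $d$-tuples $\mathbf x:=(x_1,\dots,x_d)$ and $(y_1,\dots,y_d)$ in $R$ with $\mathbf x$ a system of parameters, we have an inequality $$\operatorname{ord}_R(x_1y_1+\dots+x_dy_d)\leq\delta_R\bigl(\ell(R/\mathbf xR),\ \operatorname{ord}_{R/(x_1,\dots,x_{d-1})R}(y_d)\bigr).$$ Moreover, the function $\delta_R$ (for $R$ Cohen-Macaulay) only depends on the dimension and the multiplicity of $R$; that is, for given $d$ and $e$ one function can be chosen that works for all $d$-dimensional local Cohen-Macaulay rings of multiplicity $e$.
   Context: Put $\bar{\mathbb N}:=\mathbb N\cup\{\infty\}$. An $n$-ary numerical function is a map $f\colon\bar{\mathbb N}^n\to\bar{\mathbb N}$ such that $f(s_1,\dots,s_n)=\infty$ if and only if some $s_i=\infty$, and which is non-decreasing in each argument. For a local ring $(A,\mathfrak n)$ and $x\in A$, the order $\operatorname{ord}_A(x)$ is the supremum (possibly $\infty$) of all $n$ with $x\in\mathfrak n^n$; for an element $y$ of $R$ and a residue ring $A$ of $R$, $\operatorname{ord}_A(y)$ denotes the order of the image of $y$ in $A$. $\ell$ denotes length. *)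

(* Defs.v *)
From HB Require Import structures.
From mathcomp Require Import all_boot all_order all_algebra.
From mathcomp Require Import boolp.

Set Implicit Arguments.
Unset Strict Implicit.
Unset Printing Implicit Defensive.

Import GRing.Theory.
Local Open Scope ring_scope.
Local Open Scope quotient_scope.

(* Rings are commutative with 1, possibly zero, so that R/I makes sense for   *)
(* every ideal I; a local ring is nonzero since it has a maximal ideal.       *)

Inductive enat := Fin of nat | Inf.

Definition enat_le (a b : enat) : Prop :=
  match a, b with
  | _, Inf => True
  | Inf, Fin _ => False
  | Fin m, Fin n => (m <= n)%N
  end.

(* Supremum in enat of a set of naturals (0 for the empty set).               *)
Definition enat_sup (P : nat -> Prop) : enat :=
  match pselect (exists b, `[< forall n, P n -> (n <= b)%N >]) with
  | left bounded => Fin (ex_minn bounded)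
  | right _ => Inf
  end.

Definition numerical_function (n : nat) (f : n.-tuple enat -> enat) : Prop :=
  (forall s, f s = Inf <-> exists i, tnth s i = Inf) /\
  (forall (i : 'I_n) (s t : n.-tuple enat),
     (forall j, j != i -> tnth s j = tnth t j) ->
     enat_le (tnth s i) (tnth t i) -> enat_le (f s) (f t)).

(* There is a strictly increasing chain C_0 < ... < C_n of subsets satisfying P. *)
Definition has_chain (T : Type) (P : {pred T} -> Prop) (n : nat) : Prop :=
  exists C : nat -> {pred T},
    (forall i, (i <= n)%N -> P (C i)) /\
    (forall i, (i < n)%N ->
       {subset C i <= C i.+1} /\ ~ {subset C i.+1 <= C i}).

Definition mod_length (R : pzRingType) (M : lmodType R) : enat :=
  enat_sup (has_chain (fun N : {pred M} => submod_closed N)).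

Section Ideals.
Variable R : comPzRingType.
Implicit Types (I J P S : {pred R}).

Definition is_ideal I : Prop := @submod_closed R R^o I.

Definition prime_ideal P : Prop :=
  [/\ is_ideal P, 1 \notin P &
      forall a b, a * b \in P -> (a \in P) || (b \in P)].

Definition maximal_ideal I : Prop :=
  [/\ is_ideal I, 1 \notin I &
      forall J, is_ideal J -> 1 \notin J -> {subset I <= J} -> J =i I].

Definition ideal_gen S : {pred R} :=
  [pred x | `[< forall I, is_ideal I -> {subset S <= I} -> x \in I >]].

Definition ideal_mul I J : {pred R} :=
  ideal_gen [pred z | `[< exists a b, [/\ a \in I, b \in J & z = a * b] >]].

Fixpoint ideal_exp I (n : nat) : {pred R} :=
  if n is n'.+1 then ideal_mul I (ideal_exp I n') else predT.

Definition noetherian : Prop :=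
  forall I, is_ideal I -> exists s : seq R, I =i ideal_gen [in s].

Definition local_ring : Prop :=
  exists2 m, maximal_ideal m & forall n, maximal_ideal n -> n =i m.

(* The intersection of all maximal ideals: in a local ring, this is its       *)
(* unique maximal ideal.                                                      *)
Definition maxideal : {pred R} :=
  [pred x | `[< forall m, maximal_ideal m -> x \in m >]].

Definition krull_dim : enat := enat_sup (has_chain prime_ideal).

Definition ord (x : R) : enat :=
  enat_sup (fun n => x \in ideal_exp maxideal n).

Lemma ideal_gen_ideal S : is_ideal (ideal_gen S).
Proof.
split=> [|a u v /asboolP uS /asboolP vS]; apply/asboolP => I idI SI.
  by case: idI.
by case: (idI) => _; apply; [exact: uS | exact: vS].
Qed.

Lemma ideal_gen_zmod S : zmod_closed (ideal_gen S).
Proof.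
case: (ideal_gen_ideal S) => S0 SL; split=> // u v uS vS.
have -> : u - v = (-1 : R) *: (v : R^o) + u by rewrite scaleN1r addrC.
exact: SL.
Qed.

HB.instance Definition _ S :=
  GRing.isZmodClosed.Build R (ideal_gen S) (ideal_gen_zmod S).

Lemma ideal_genM S a u : u \in ideal_gen S -> a * u \in ideal_gen S.
Proof.
case: (ideal_gen_ideal S) => S0 SL uS.
by have := SL a u 0 uS S0; rewrite addr0.
Qed.

End Ideals.

Arguments maxideal : clear implicits.

(* The residue ring R/(S), where (S) is the ideal generated by S. MathComp's  *)
(* {ideal_quot I} is restricted to proper ideals, so only its additive group  *)
(* is reused.                                                                 *)
Definition residue (R : comPzRingType) (S : {pred R}) : Type :=
  Quotient.quot (ideal_gen S).

Section Residue.
Variables (R : comPzRingType) (S : {pred R}).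
Local Notation Q := (residue S).

HB.instance Definition _ := Quotient.on Q.
HB.instance Definition _ := GRing.Zmodule.on Q.

Definition residue_one : Q := \pi_Q 1.
Definition residue_mul (u v : Q) : Q := \pi_Q (repr u * repr v).

Lemma residue_eq (x y : R) :
  \pi_Q x = \pi_Q y <-> x - y \in ideal_gen S.
Proof.
rewrite (Quotient.idealrBE (ideal_gen S)); split=> [->|/eqP] //.
Qed.

Lemma residue_mulE (x y : R) :
  residue_mul (\pi_Q x) (\pi_Q y) = \pi_Q (x * y).
Proof.
apply/residue_eq.
have hx : repr (\pi_Q x) - x \in ideal_gen S by apply/residue_eq; rewrite reprK.
have hy : repr (\pi_Q y) - y \in ideal_gen S by apply/residue_eq; rewrite reprK.
set x' := repr _ in hx *; set y' := repr _ in hy *.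
have -> : x' * y' - x * y = x' * (y' - y) + y * (x' - x).
  by rewrite !mulrBr addrA (mulrC y x') subrK (mulrC y x).
by rewrite rpredD // ideal_genM.
Qed.

Lemma residue_addE (x y : R) : \pi_Q x + \pi_Q y = \pi_Q (x + y).
Proof. by symmetry; exact: (Quotient.pi_add (ideal_gen S) x y). Qed.

Lemma residue_mulA : associative residue_mul.
Proof.
elim/quotW=> x; elim/quotW=> y; elim/quotW=> z.
by rewrite (residue_mulE y z) (residue_mulE x y) !residue_mulE mulrA.
Qed.

Lemma residue_mulC : commutative residue_mul.
Proof. by move=> u v; rewrite /residue_mul mulrC. Qed.

Lemma residue_mul1 : left_id residue_one residue_mul.
Proof. by elim/quotW=> x; rewrite residue_mulE mul1r. Qed.

Lemma residue_mulD : left_distributive residue_mul +%R.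
Proof.
elim/quotW=> x; elim/quotW=> y; elim/quotW=> z.
rewrite residue_addE (residue_mulE x z) (residue_mulE y z) residue_mulE.
by rewrite residue_addE mulrDl.
Qed.

HB.instance Definition _ := GRing.Zmodule_isComPzRing.Build Q
  residue_mulA residue_mulC residue_mul1 residue_mulD.

Definition residue_scale (a : R) (u : Q) : Q := \pi_Q a * u.

Lemma residue_scaleA a b u :
  residue_scale a (residue_scale b u) = residue_scale (a * b) u.
Proof.
rewrite /residue_scale mulrA; congr (_ * u); exact: residue_mulE.
Qed.

Lemma residue_scale1 : left_id 1 residue_scale.
Proof. exact: residue_mul1. Qed.

Lemma residue_scaleDr : right_distributive residue_scale +%R.
Proof. by move=> a u v; rewrite /residue_scale mulrDr. Qed.

Lemma residue_scaleDl u : {morph residue_scale^~ u : a b / a + b}.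
Proof. by move=> a b; rewrite /residue_scale -residue_addE mulrDl. Qed.

HB.instance Definition _ := GRing.Zmodule_isLmodule.Build R Q
  residue_scaleA residue_scale1 residue_scaleDr residue_scaleDl.

End Residue.

Section LocalAlgebra.
Variable R : comPzRingType.

Definition sop (d : nat) (x : d.-tuple R) : Prop :=
  [/\ krull_dim R = Fin d,
      {subset x <= maxideal R} &
      exists n, {subset ideal_exp (maxideal R) n <= ideal_gen [in x]}].

Definition regular_sequence (s : seq R) : Prop :=
  (1 : residue [in s]) != 0 /\
  forall i, (i < size s)%N ->
    forall u : residue [in take i s], s`_i *: u = 0 -> u = 0.

Definition depth : enat :=
  enat_sup (fun n => exists s : n.-tuple R,
    {subset s <= maxideal R} /\ regular_sequence s).

Definition cohen_macaulay : Prop :=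
  [/\ noetherian R, local_ring R & depth = krull_dim R].

(* The multiplicity of a Noetherian local ring of dimension d is d! times the *)
(* coefficient of degree d of its Hilbert-Samuel polynomial.                  *)
Definition has_multiplicity (e : nat) : Prop :=
  exists (d : nat) (p : {poly rat}),
    [/\ krull_dim R = Fin d,
        exists N, forall n, (N <= n)%N -> exists2 l,
          mod_length (residue (ideal_exp (maxideal R) n.+1)) = Fin l &
          p.[n%:R] = l%:R &
        e%:R = d`!%:R * p`_d].

(* With 0-based indices, x_d is x`_d.-1 and (x_1, ..., x_(d-1)) is            *)
(* take d.-1 x.                                                               *)
Definition order_bound (d : nat) (delta : 2.-tuple enat -> enat) : Prop :=
  forall x y : d.-tuple R, sop x ->
    enat_le (ord (\sum_(i < d) x`_i * y`_i))
      (delta [tuple mod_length (residue [in x]);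
                    ord (\pi_(residue [in take d.-1 x]) y`_d.-1)]).

End LocalAlgebra.

(* Main.v *)
(* The function delta(l, n) = l + n works for every Cohen-Macaulay R: the       *)
(* length l of R/(x) puts m^l in (x); so, with J = (x_1, ..., x_(d-1)), modulo *)
(* J an element of m^N lies in x_d m^(N-l); since x_d is regular modulo J,     *)
(* x_d y_d in m^N + J forces y_d in m^(N-l) + J.  That x_d is regular modulo J *)
(* for every system of parameters is obtained from the acyclicity of the       *)
(* Koszul complex in a ring of depth d.                                        *)
(*   Conversely, taking (y_i) with vanishing sum of x_i y_i, a bound shows     *)
(* that x_d is regular modulo J for every system of parameters, because y_d    *)
(* has finite order modulo J unless it vanishes there.  Applying this to       *)
(* x_1, ..., x_i, x_(i+2)^n, ..., x_d^n, x_(i+1) and letting n grow, Krull's   *)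
(* intersection theorem shows that x_(i+1) is regular modulo (x_1, ..., x_i).  *)
From HB Require Import structures.
From mathcomp Require Import all_boot all_order all_algebra.
From mathcomp Require Import boolp.
From mathcomp Require Import ring.
Require Import Defs.

Set Implicit Arguments.
Unset Strict Implicit.
Unset Printing Implicit Defensive.

Import GRing.Theory.
Local Open Scope ring_scope.
Local Open Scope quotient_scope.

(** Both directions turn on whether x_d is regular modulo J = (x_1, ..., x_(d-1)) for every system
    of parameters x. If R is Cohen-Macaulay, it is: a regular sequence of length d in m has powers
    in (x), so the Koszul complex of x has no first homology ([kos_acyclic]), and a relation x_d r
    in J, read as a 1-cycle, forces r in J ([last_regular]). With l the length of R/(x),
    [exp_sub_length] puts m^l in (x), hence m^N in J + x_d m^(N-l). Cancelling x_d, a sum of the x_i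
    y_i in m^N forces y_d in J + m^(N-l). So addition ([order_delta]) bounds the order, the same
    function for all these rings. Conversely, under a bound a vanishing sum of the x_i y_i makes y_d
    of infinite order modulo J, that is, y_d in J by Krull's intersection theorem ([last_colon]).
    Regularity of the last entry of every system of parameters spreads to all entries
    ([sop_regular]). As a system of parameters exists ([exists_sop]), the depth is at least d. It is
    at most d because a regular sequence of length n yields a chain of primes of length n
    ([height_regular]). *)

(** * Suprema of sets of naturals *)

Lemma enat_sup_le (P : nat -> Prop) k :
  enat_le (enat_sup P) (Fin k) <-> forall n, P n -> (n <= k)%N.
Proof.
rewrite /enat_sup; case: pselect => [bnd|nbnd] /=.
  case: ex_minnP => b /asboolP Pb minb; split=> [lebk n /Pb /leq_trans->//|Pk].
  by apply: minb; apply/asboolP.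
by split=> // Pk; apply: nbnd; exists k; apply/asboolP.
Qed.

Lemma enat_sup_fin (P : nat -> Prop) k :
  (forall n, P n -> (n <= k)%N) -> exists l, enat_sup P = Fin l.
Proof. by move/enat_sup_le; case: (enat_sup P) => // l _; exists l. Qed.

Lemma enat_sup_inf (P : nat -> Prop) : (forall n, P n) -> enat_sup P = Inf.
Proof.
move=> Pn; case E: (enat_sup P) => [k|//].
have /enat_sup_le/(_ k.+1 (Pn _)) : enat_le (enat_sup P) (Fin k) by rewrite E /=.
by rewrite ltnn.
Qed.

Lemma enat_sup_max (P : nat -> Prop) k :
  P k -> (forall n, P n -> (n <= k)%N) -> enat_sup P = Fin k.
Proof.
move=> Pk bnd; have [l E] := enat_sup_fin bnd; rewrite E; congr Fin.
apply/eqP; rewrite eqn_leq; apply/andP; split.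
  by move/enat_sup_le: bnd; rewrite E.
by have /enat_sup_le/(_ k Pk) : enat_le (enat_sup P) (Fin l) by rewrite E /=.
Qed.

Lemma enat_sup_ub (P : nat -> Prop) k n :
  enat_sup P = Fin k -> P n -> (n <= k)%N.
Proof.
by move=> E; have /enat_sup_le : enat_le (enat_sup P) (Fin k); [rewrite E /=|apply].
Qed.

(** Positivity of k matters: the empty set also has supremum 0. *)
Lemma enat_sup_attained (P : nat -> Prop) k :
  (0 < k)%N -> enat_sup P = Fin k -> P k.
Proof.
move=> k0 E; apply: contrapT => nPk.
have /enat_sup_le : forall n, P n -> (n <= k.-1)%N.
  move=> n Pn; have := enat_sup_ub E Pn; rewrite leq_eqVlt => /orP[/eqP nk|].
    by case: nPk; rewrite -nk.
  by case: k k0 {E nPk}.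
by rewrite E /=; case: k k0 {E nPk} => // k _; rewrite ltnn.
Qed.

(** * Sums, products and powers of ideals *)

Section Ideals.
Variable R : comPzRingType.
Implicit Types (I J K P Q S : {pred R}).

Lemma ideal0 I : is_ideal I -> 0 \in I. Proof. by case. Qed.

Lemma idealD I u v : is_ideal I -> u \in I -> v \in I -> u + v \in I.
Proof. by case=> _ IL uI vI; have := IL 1 u v uI vI; rewrite scale1r. Qed.

Lemma idealMl I a u : is_ideal I -> u \in I -> a * u \in I.
Proof. by case=> I0 IL uI; have := IL a u 0 uI I0; rewrite addr0. Qed.

Lemma idealMr I a u : is_ideal I -> u \in I -> u * a \in I.
Proof. by rewrite mulrC; exact: idealMl. Qed.

Lemma idealN I u : is_ideal I -> u \in I -> - u \in I.
Proof. by move=> idI uI; rewrite -mulN1r idealMl. Qed.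

Lemma idealB I u v : is_ideal I -> u \in I -> v \in I -> u - v \in I.
Proof. by move=> idI uI vI; rewrite idealD// idealN. Qed.

Lemma idealBK I u v : is_ideal I -> u - v \in I -> v \in I -> u \in I.
Proof. by move=> idI uvI vI; rewrite -(subrK v u) idealD. Qed.

Lemma is_idealP I : 0 \in I -> (forall u v, u \in I -> v \in I -> u + v \in I) ->
  (forall a u, u \in I -> a * u \in I) -> is_ideal I.
Proof. by move=> I0 ID IM; split=> // a u v uI vI; apply: ID => //; apply: IM. Qed.

Lemma ideal1 I x : is_ideal I -> 1 \in I -> x \in I.
Proof. by move=> idI I1; rewrite -[x]mulr1 idealMl. Qed.

Lemma sub_ideal_gen S : {subset S <= ideal_gen S}.
Proof. by move=> x xS; apply/asboolP => I _; apply. Qed.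

Lemma ideal_gen_sub S I : is_ideal I -> {subset S <= I} ->
  {subset ideal_gen S <= I}.
Proof. by move=> idI SI x /asboolP; apply. Qed.

Lemma ideal_gen_mono S S' : {subset S <= S'} ->
  {subset ideal_gen S <= ideal_gen S'}.
Proof.
move=> SS'; apply: ideal_gen_sub; first exact: ideal_gen_ideal.
by move=> x /SS'; exact: sub_ideal_gen.
Qed.

(* The sum I + J. *)
Definition idealS I J : {pred R} := [pred z | `[< exists2 v, v \in J & z - v \in I >]].

Lemma idealSP I J : is_ideal I -> is_ideal J -> is_ideal (idealS I J).
Proof.
move=> idI idJ; apply: is_idealP.
- by apply/asboolP; exists 0; rewrite ?subrr ideal0.
- move=> u v /asboolP[u' Ju uI] /asboolP[v' Jv vI]; apply/asboolP.
  by exists (u' + v'); [exact: idealD | rewrite opprD addrACA idealD].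
- move=> a u /asboolP[u' Ju uI]; apply/asboolP.
  by exists (a * u'); [exact: idealMl | rewrite -mulrBr idealMl].
Qed.

Lemma sub_idealSl I J : is_ideal J -> {subset I <= idealS I J}.
Proof. by move=> idJ x xI; apply/asboolP; exists 0; rewrite ?subr0 ?ideal0. Qed.

Lemma sub_idealSr I J : is_ideal I -> {subset J <= idealS I J}.
Proof. by move=> idI x xJ; apply/asboolP; exists x; rewrite ?subrr ?ideal0. Qed.

Lemma idealS_sub I J K : is_ideal K -> {subset I <= K} -> {subset J <= K} ->
  {subset idealS I J <= K}.
Proof. by move=> idK IK JK x /asboolP[v /JK vK /IK]; move=> /idealBK; exact. Qed.

Definition principal (a : R) : {pred R} := [pred z | `[< exists r, z = r * a >]].

Lemma principal_ideal a : is_ideal (principal a).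
Proof.
apply: is_idealP.
- by apply/asboolP; exists 0; rewrite mul0r.
- move=> u v /asboolP[r ->] /asboolP[s ->]; apply/asboolP.
  by exists (r + s); rewrite mulrDl.
- by move=> b u /asboolP[r ->]; apply/asboolP; exists (b * r); rewrite mulrA.
Qed.

Lemma mem_principal a : a \in principal a.
Proof. by apply/asboolP; exists 1; rewrite mul1r. Qed.

Definition adjoin I a := idealS I (principal a).

Lemma adjoinP I a z : reflect (exists r, z - r * a \in I) (z \in adjoin I a).
Proof.
apply: (iffP (asboolP _)) => [[_ /asboolP[r ->]]|[r zI]]; first by exists r.
by exists (r * a) => //; apply/asboolP; exists r.
Qed.

Lemma adjoin_ideal I a : is_ideal I -> is_ideal (adjoin I a).
Proof. by move=> idI; apply: idealSP => //; exact: principal_ideal. Qed.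

Lemma sub_adjoin I a : {subset I <= adjoin I a}.
Proof. by apply: sub_idealSl; exact: principal_ideal. Qed.

Lemma mem_adjoin I a : is_ideal I -> a \in adjoin I a.
Proof. by move=> idI; apply: sub_idealSr => //; exact: mem_principal. Qed.

Lemma adjoin_sub I a K : is_ideal K -> {subset I <= K} -> a \in K ->
  {subset adjoin I a <= K}.
Proof.
move=> idK IK aK; apply: idealS_sub => // _ /asboolP[r ->]; exact: idealMl.
Qed.

Lemma ideal_gen_rcons (s : seq R) a z :
  z \in ideal_gen [in rcons s a] -> z \in adjoin (ideal_gen [in s]) a.
Proof.
apply: ideal_gen_sub; first exact/adjoin_ideal/ideal_gen_ideal.
move=> y; rewrite inE mem_rcons inE => /orP[/eqP->|ys].
  exact/mem_adjoin/ideal_gen_ideal.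
exact/sub_adjoin/sub_ideal_gen.
Qed.

Lemma sub_ideal_gen_rcons (s : seq R) a :
  {subset ideal_gen [in s] <= ideal_gen [in rcons s a]}.
Proof.
apply: ideal_gen_mono => x xs.
have : x \in rcons s a by rewrite mem_rcons inE orbC (xs : x \in s).
by [].
Qed.

Lemma mem_ideal_gen_rcons (s : seq R) a : a \in ideal_gen [in rcons s a].
Proof.
apply: sub_ideal_gen; have : a \in rcons s a by rewrite mem_rcons mem_head.
by [].
Qed.

Lemma ideal_gen_nil z : z \in ideal_gen [in [::] : seq R] -> z = 0.
Proof.
have id0 : is_ideal (pred1 (0 : R)).
  apply: is_idealP => [|u v|a u]; rewrite !inE // => /eqP->.
    by move=> /eqP->; rewrite addr0.
  by rewrite mulr0.
by move/asboolP/(_ _ id0) => H; apply/eqP; apply: H => x; rewrite inE in_nil.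
Qed.

Lemma ideal_gen_sum (s : seq R) z : z \in ideal_gen [in s] ->
  exists c : nat -> R, z = \sum_(i < size s) s`_i * c i.
Proof.
elim/last_ind: s z => [|s a IHs] z.
  by move/ideal_gen_nil->; exists (fun=> 0); rewrite big_ord0.
move/ideal_gen_rcons/adjoinP => [r /IHs[c E]].
exists (fun i => if (i < size s)%N then c i else r).
rewrite size_rcons big_ord_recr /= ltnn nth_rcons ltnn eqxx.
apply/eqP; rewrite [_ * r]mulrC -subr_eq E; apply/eqP/eq_bigr => i _.
by rewrite nth_rcons ltn_ord.
Qed.

Lemma sum_ideal_gen (s : seq R) (c : nat -> R) n : (n <= size s)%N ->
  \sum_(i < n) s`_i * c i \in ideal_gen [in s].
Proof.
have idg := ideal_gen_ideal [in s].
elim: n => [|n IHn] lens; first by rewrite big_ord0 ideal0.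
rewrite big_ord_recr idealD ?IHn// 1?ltnW// mulrC idealMl//.
by apply: sub_ideal_gen; exact: mem_nth.
Qed.

Lemma ideal_mul_mem I J a b : a \in I -> b \in J -> a * b \in ideal_mul I J.
Proof. by move=> aI bJ; apply: sub_ideal_gen; apply/asboolP; exists a, b. Qed.

Lemma ideal_mul_sub I J K : is_ideal K ->
  (forall a b, a \in I -> b \in J -> a * b \in K) -> {subset ideal_mul I J <= K}.
Proof.
by move=> idK IJK; apply: ideal_gen_sub => // _ /asboolP[a [b [aI bJ ->]]]; exact: IJK.
Qed.

Lemma ideal_exp_ideal I n : is_ideal (ideal_exp I n).
Proof. by case: n => [|n] /=; [split | exact: ideal_gen_ideal]. Qed.

Lemma ideal_exp_anti I m n : (m <= n)%N ->
  {subset ideal_exp I n <= ideal_exp I m}.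
Proof.
move=> /subnK <-; elim: (n - m)%N => // k IHk; rewrite addSn => x xI.
apply: IHk; move: x xI; apply: ideal_mul_sub; first exact: ideal_exp_ideal.
by move=> a b _; apply: idealMl; exact: ideal_exp_ideal.
Qed.

Lemma colon_ideal K a : is_ideal K -> is_ideal [pred z | a * z \in K].
Proof.
move=> idK; apply: is_idealP => [|u v|b u]; rewrite !inE.
- by rewrite mulr0 ideal0.
- by move=> uK vK; rewrite mulrDr idealD.
- by move=> uK; rewrite mulrCA idealMl.
Qed.

(** Induction on p: for c in I, the ideal K is replaced by the colon ideal of K by c. *)
Lemma ideal_exp_addS I K p q : is_ideal K ->
  (forall a b, a \in ideal_exp I p -> b \in ideal_exp I q -> a * b \in K) ->
  {subset ideal_exp I (p + q) <= K}.
Proof.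
elim: p K => [|p IHp] K idK pqK.
  by move=> x xI; rewrite -[x]mul1r; exact: pqK.
rewrite addSn; apply: ideal_mul_sub => // c w cI.
apply: (IHp [pred z | c * z \in K]); first exact: colon_ideal.
by move=> a b aI bI; rewrite inE mulrA pqK// ideal_mul_mem.
Qed.

Lemma ideal_expD I p q a b : a \in ideal_exp I p -> b \in ideal_exp I q ->
  a * b \in ideal_exp I (p + q).
Proof.
move=> + bI; elim: p a => [|p IHp] a.
  by move=> _; apply: idealMl => //; exact: ideal_exp_ideal.
apply: (ideal_mul_sub (K := [pred a | a * b \in ideal_exp I (p.+1 + q)])).
  by under eq_fun do rewrite mulrC; apply: colon_ideal; exact: ideal_exp_ideal.
by move=> c w cm wm; rewrite inE -mulrA; apply: ideal_mul_mem => //; exact: IHp.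
Qed.

Lemma ideal_expX I a n : a \in I -> a ^+ n \in ideal_exp I n.
Proof. by move=> aI; elim: n => // n IHn; rewrite exprS /= ideal_mul_mem. Qed.

Lemma prime_exp P a n : prime_ideal P -> a ^+ n \in P -> a \in P.
Proof.
case=> _ P1 PM; elim: n => [|n IHn]; first by rewrite expr0 (negPf P1).
by rewrite exprS => /PM/orP[|/IHn].
Qed.

Lemma prime_ideal_exp P I n : prime_ideal P ->
  {subset ideal_exp I n <= P} -> {subset I <= P}.
Proof. by move=> pP InP x xI; apply: (prime_exp pP); exact/InP/ideal_expX. Qed.

End Ideals.

(** * Primes in Noetherian rings *)

Section Noetherian.
Variable R : comPzRingType.
Hypothesis noethR : noetherian R.
Implicit Types (I J K P Q S : {pred R}) (F : {pred R} -> Prop).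

(** Without a maximal element, dependent choice builds a strictly increasing sequence of ideals. Its
    union is finitely generated, so equal to one of its members, a contradiction. *)
Lemma noetherian_maximal F I0 : is_ideal I0 -> F I0 ->
  exists I, [/\ is_ideal I, F I, {subset I0 <= I} &
    forall J, is_ideal J -> F J -> {subset I <= J} -> {subset J <= I}].
Proof.
move=> idI0 FI0; apply: contrapT => nomax.
pose T := {I | [/\ is_ideal I, F I & {subset I0 <= I}]}.
have step (t : T) : exists t' : T,
    {subset sval t <= sval t'} /\ ~ {subset sval t' <= sval t}.
  case: t => I [idI FI I0I] /=; apply: contrapT => nostep; apply: nomax.
  exists I; split=> // J idJ FJ IJ; apply: contrapT => nJI.
  have tJ : [/\ is_ideal J, F J & {subset I0 <= J}].
    by split=> // x /I0I/IJ.
  by apply: nostep; exists (exist _ J tJ).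
have [f fP] := choice step.
have t0 : T := exist _ I0 (And3 idI0 FI0 (fun x xI => xI)).
pose C n := sval (iter n f t0).
have Cid n : is_ideal (C n) by rewrite /C; case: (iter n f t0) => I [].
have Cmono m n : (m <= n)%N -> {subset C m <= C n}.
  move=> /subnK <-; elim: (n - m)%N => // k IHk x /IHk.
  by rewrite addSn /C iterS; apply: (fP _).1.
pose U : {pred R} := [pred x | `[< exists n, x \in C n >]].
have idU : is_ideal U.
  apply: is_idealP.
  - by apply/asboolP; exists 0%N; apply: ideal0.
  - move=> u v /asboolP[m um] /asboolP[n vn]; apply/asboolP; exists (maxn m n).
    by apply: idealD => //; [apply: Cmono um | apply: Cmono vn];
      rewrite ?leq_maxl ?leq_maxr.
  - by move=> a u /asboolP[m um]; apply/asboolP; exists m; exact: idealMl.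
have [s Us] := noethR idU.
have [N sN] : exists N, {subset s <= C N}.
  have sU : {subset s <= U} by move=> x xs; rewrite Us; exact: sub_ideal_gen.
  elim: s sU {Us} => [|a s IHs] sU; first by exists 0%N.
  have /asboolP[m am] := sU a (mem_head _ _).
  have [x xs|n sn] := IHs _; first by rewrite sU// inE xs orbT.
  exists (maxn m n) => x; rewrite inE => /orP[/eqP->|/sn].
    by apply: Cmono am; exact: leq_maxl.
  by apply: Cmono; exact: leq_maxr.
apply: (fP (iter N f t0)).2 => x xS.
have : x \in U by apply/asboolP; exists N.+1.
rewrite Us; apply: ideal_gen_sub; [exact: Cid | exact: sN].
Qed.

(** The common source of the primes below: an ideal maximal for F is prime as soon as F excludes the
    unit ideal and, when a b lies in I, passes from I to I + (a) or to I + (b). *)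
Lemma prime_of_maximal F I0 : is_ideal I0 -> F I0 ->
  (forall I, is_ideal I -> F I -> 1 \notin I) ->
  (forall I a b, is_ideal I -> a * b \in I -> F I ->
     F (adjoin I a) \/ F (adjoin I b)) ->
  exists P, [/\ prime_ideal P, F P & {subset I0 <= P}].
Proof.
move=> idI0 FI0 F1 FM; have [P [idP FP I0P maxP]] := noetherian_maximal idI0 FI0.
exists P; split=> //; split=> // [|a b abP]; first exact: F1.
have adj c : F (adjoin P c) -> c \in P.
  move=> Fc; apply: (maxP (adjoin P c)) => //; first exact: adjoin_ideal.
    exact: sub_adjoin.
  exact: mem_adjoin.
by case: (FM P a b idP abP FP) => /adj ->; rewrite ?orbT.
Qed.

Lemma adjoinM I a b r s u v : is_ideal I -> a * b \in I ->
  u - r * a \in I -> v - s * b \in I -> u * v \in I.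
Proof.
move=> idI abI uI vI.
have -> : u * v = u * (v - s * b) + (s * b) * (u - r * a) + (r * s) * (a * b).
  by ring.
by apply: idealD => //; [apply: idealD => // |]; exact: idealMl.
Qed.

Lemma prime_not_exp I J : is_ideal J -> (forall n, ~ {subset ideal_exp I n <= J}) ->
  exists P, [/\ prime_ideal P, {subset J <= P} & ~ {subset I <= P}].
Proof.
move=> idJ nJ.
have [||P [pP nP JP]] := prime_of_maximal
  (F := fun K => forall n, ~ {subset ideal_exp I n <= K}) idJ nJ.
- by move=> K idK nK; apply/negP => /(ideal1 _ idK) K1; apply: (nK 0%N) => x _.
- move=> K a b idK abK nK; apply: contrapT => /not_orP[/existsNP[m /contrapT ma]].
  move=> /existsNP[n /contrapT nb]; apply: (nK (m + n)%N).
  apply: ideal_exp_addS => // u v /ma/adjoinP[r ur] /nb/adjoinP[s vs].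
  exact: adjoinM idK abK ur vs.
exists P; split=> // IP; apply: (nP 1%N) => x.
by case: pP => idP _ _; apply: ideal_mul_sub => // a b /IP aP _; exact: idealMr.
Qed.

(** P is maximal among the ideals missing the multiplicative set of all s x^k with s outside Q. This
    stands in for localising at Q and inverting x. *)
Lemma prime_avoiding Q J x : prime_ideal Q -> is_ideal J ->
  (forall s k, s \notin Q -> s * x ^+ k \notin J) ->
  exists P, [/\ prime_ideal P, {subset J <= P}, {subset P <= Q} & x \notin P].
Proof.
move=> [idQ Q1 QM] idJ FJ.
pose F K := forall s k, s \notin Q -> s * x ^+ k \notin K.
have [||P [pP FP JP]] := prime_of_maximal (F := F) idJ FJ.
- by move=> K idK /(_ 1 0%N Q1); rewrite mul1r.
- move=> K a b idK abK FK; apply: contrapT => /not_orP[].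
  move=> /existsNP[s /existsNP[k /not_implyP[sQ /negP/negPn/adjoinP[p Hp]]]].
  move=> /existsNP[t /existsNP[l /not_implyP[tQ /negP/negPn/adjoinP[q Hq]]]].
  have stQ : s * t \notin Q by apply/negP => /QM; rewrite (negPf sQ) (negPf tQ).
  by move/negP: (FK _ (k + l)%N stQ); apply; rewrite exprD mulrACA;
    exact: adjoinM idK abK Hp Hq.
exists P; split=> // [a aP|].
  by apply/negPn/negP => aQ; have := FP a 0%N aQ; rewrite mulr1 aP.
by have := FP 1 1%N Q1; rewrite mul1r.
Qed.

(** Noetherian induction: an ideal maximal among the counterexamples would be prime, and a prime is
    its own list. *)
Lemma finite_primes_over J : is_ideal J -> exists L : seq {pred R},
  (forall Q, List.In Q L -> prime_ideal Q /\ {subset J <= Q}) /\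
  forall P, prime_ideal P -> {subset J <= P} ->
    exists2 Q, List.In Q L & {subset Q <= P}.
Proof.
move=> idJ; apply: contrapT => FJ.
have [||P [pP FP JP]] := prime_of_maximal (F := fun J => ~ exists L,
  (forall Q, List.In Q L -> prime_ideal Q /\ {subset J <= Q}) /\
  forall P, prime_ideal P -> {subset J <= P} ->
    exists2 Q, List.In Q L & {subset Q <= P}) idJ FJ.
- move=> K idK FK; apply/negP => K1; apply: FK; exists [::]; split=> // P.
  by case=> _ /negP P1 _ KP; case: P1; exact: KP.
- move=> K a b idK abK FK; apply: contrapT => /not_orP[/contrapT[La [La1 La2]]].
  move=> /contrapT[Lb [Lb1 Lb2]]; apply: FK; exists (La ++ Lb); split.
    move=> Q /List.in_app_iff[/La1|/Lb1] [pQ KQ]; split=> // x xK;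
      by apply: KQ; exact: sub_adjoin.
  move=> P pP KP; have [idP _ PM] := pP; have /PM/orP[xP|xP] := KP _ abK.
    have [|Q] := La2 P pP; first exact: adjoin_sub.
    by exists Q => //; apply/List.in_app_iff; left.
  have [|Q] := Lb2 P pP; first exact: adjoin_sub.
  by exists Q => //; apply/List.in_app_iff; right.
apply: FP; exists [:: P]; split=> [Q [<-|//]|Q pQ PQ]; first by split.
by exists P => //; left.
Qed.

Lemma prime_separation I P (L : seq {pred R}) : is_ideal I ->
  (forall Q, List.In Q L -> prime_ideal Q) ->
  prime_ideal P -> ~ {subset I <= P} ->
  exists y, [/\ y \in I, y \notin P &
    forall Q, List.In Q L -> ~ {subset Q <= P} -> y \in Q].
Proof.
move=> idI pL pP nIP; have [idP P1 PM] := pP.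
have sep K : ~ {subset K <= P} -> exists2 a, a \in K & a \notin P.
  by move=> /existsNP[a /not_implyP[aK /negP aP]]; exists a.
elim: L pL => [|Q L IHL] pL.
  by have [y yI yP] := sep _ nIP; exists y.
have [y [yI yP yL]] := IHL (fun K LK => pL K (or_intror LK)).
have [QP|/sep[a aQ aP]] := pselect {subset Q <= P}.
  by exists y; split=> // K [<-|/yL].
exists (a * y); split; first exact: idealMl.
  by apply/negP => /PM; rewrite (negPf aP) (negPf yP).
move=> K [<- _|LK nKP]; first by rewrite idealMr//; case: (pL Q (or_introl erefl)).
by rewrite idealMl//; [case: (pL K (or_intror LK)) | exact: yL].
Qed.

(** If the x found for the tail lies in P, it is corrected by some y in I outside P that lies in
    every Q of the tail not contained in P. The primes Q inside P are avoided because P is. *)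
Lemma prime_avoidance I (L : seq {pred R}) : is_ideal I ->
  (forall Q, List.In Q L -> prime_ideal Q /\ ~ {subset I <= Q}) ->
  exists2 x, x \in I & forall Q, List.In Q L -> x \notin Q.
Proof.
move=> idI; elim: L => [|P L IHL] pL; first by exists 0; rewrite ?ideal0.
have [x xI xL] := IHL (fun K LK => pL K (or_intror LK)).
have [pP nIP] := pL P (or_introl erefl); have [idP _ _] := pP.
have [xP|xP] := boolP (x \in P); last first.
  by exists x => // Q [<-|/xL].
have pL' Q : List.In Q L -> prime_ideal Q by move=> LQ; case: (pL Q (or_intror LQ)).
have [y [yI yP yL]] := prime_separation idI pL' pP nIP.
have xyP : x + y \notin P.
  apply: contra yP => xyP; rewrite -[y](addKr x) idealD//; exact: idealN.
exists (x + y); first exact: idealD.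
move=> Q [<-//|LQ]; have [QP|/(yL Q LQ) yQ] := pselect {subset Q <= P}.
  by apply: contra xyP; exact: QP.
apply: contra (xL Q LQ) => xyQ; rewrite -[x](addrK y) idealB//.
by case: (pL' Q LQ).
Qed.

(** The colon ideals of J by the powers of x increase, hence become stationary. *)
Lemma colon_exp_stable J x : is_ideal J -> exists n, forall r,
  x ^+ n.+1 * r \in J -> x ^+ n * r \in J.
Proof.
move=> idJ; pose C n : {pred R} := [pred z | x ^+ n * z \in J].
have Cid n : is_ideal (C n) by exact: colon_ideal.
have [//||I [_ [n ->] _ maxI]] :=
  @noetherian_maximal (fun I => exists n, I = C n) (C 0%N).
  by exists 0%N.
exists n; apply: (maxI (C n.+1)) => //; first by exists n.+1.
by move=> r; rewrite !inE exprS -mulrA; exact: idealMl.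
Qed.

End Noetherian.

(** * Noetherian local rings: Krull's intersection theorem and finite length *)

Section Local.
Variable R : comPzRingType.
Implicit Types (I J K P Q S : {pred R}).
Local Notation m := (maxideal R).

Lemma is_ideal_eq I J : I =i J -> is_ideal I -> is_ideal J.
Proof.
move=> IJ idI; apply: is_idealP => [|u v|a u]; rewrite -!IJ.
- exact: ideal0.
- exact: idealD.
- exact: idealMl.
Qed.

Lemma maxideal_maximal : local_ring R -> maximal_ideal m.
Proof.
move=> [n nmax nuniq]; have mn : n =i m.
  move=> x; apply/idP/asboolP => [xn k /nuniq -> //|]; exact.
have [idn n1 maxn] := nmax; split; first exact: is_ideal_eq idn.
  by rewrite -mn.
by move=> J idJ J1 mJ x; rewrite -mn; apply: maxn => // y; rewrite mn => /mJ.
Qed.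

Hypotheses (noethR : noetherian R) (localR : local_ring R).

Lemma maxideal_ideal : is_ideal m.
Proof. by case: (maxideal_maximal localR). Qed.

Lemma maxideal1 : 1 \notin m.
Proof. by case: (maxideal_maximal localR). Qed.

Lemma sub_maxideal I : is_ideal I -> 1 \notin I -> {subset I <= m}.
Proof.
move=> idI I1; have [M [idM M1 IM maxM]] :=
  noetherian_maximal noethR (F := fun I => 1 \notin I) idI I1.
have mM : maximal_ideal M.
  by split=> // J idJ J1 MJ x; apply/idP/idP => [|/MJ//]; exact: maxM.
by move=> x /IM xM; case: localR => n nmax nuniq; apply/asboolP => k /nuniq->;
  rewrite -(nuniq _ mM).
Qed.

Lemma maxideal_unit x : x \notin m -> exists y, y * x = 1.
Proof.
move=> xm; have [/asboolP[y E]|n1] := boolP (1 \in principal x); first by exists y.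
by case/negP: xm; apply: sub_maxideal n1 _ _;
  [exact: principal_ideal|exact: mem_principal].
Qed.

Lemma ideal_unitK I a u : is_ideal I -> a \notin m -> a * u \in I -> u \in I.
Proof.
move=> idI /maxideal_unit[b ba] auI; rewrite -[u]mul1r -ba -mulrA; exact: idealMl.
Qed.

Lemma maxideal_1B a : a \in m -> 1 - a \notin m.
Proof.
move=> am; apply: contra maxideal1 => /(idealBK maxideal_ideal); exact.
Qed.

Lemma maxideal_prime : prime_ideal m.
Proof.
split=> [||a b abm]; [exact: maxideal_ideal|exact: maxideal1|].
have [//|/ideal_unitK->//] := boolP (a \in m); exact: maxideal_ideal.
Qed.

Lemma prime_sub_maxideal P : prime_ideal P -> {subset P <= m}.
Proof. by case=> idP P1 _; exact: sub_maxideal. Qed.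

(** Take K over J maximal without b, so that b lies in K + (a) for each a outside K. Then m b lies
    in K, since 1 - r c is a unit for c in m. If b = r c^n modulo K with n from [colon_exp_stable],
    then c b in K gives r c^n in K, hence b in K. So every c in m has a power in K, some m^n lies in
    K, and b in J + m^n is absurd. *)
Lemma krull_intersection J b : is_ideal J ->
  (forall n, b \in idealS J (ideal_exp m n)) -> b \in J.
Proof.
move=> idJ bJ; apply/negPn/negP => bnJ.
have [K [idK bK JK maxK]] :=
  noetherian_maximal noethR (F := fun I => b \notin I) idJ bnJ.
have adjb a : a \notin K -> b \in adjoin K a.
  move=> aK; apply/negPn/negP => nb; case/negP: aK.
  apply: (maxK _ (adjoin_ideal _ idK) nb); first exact: sub_adjoin.
  exact: mem_adjoin.
have mbK c : c \in m -> c * b \in K.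
  move=> cm; apply/negPn/negP => /adjb/adjoinP[r].
  rewrite mulrA -{1}[b]mul1r -mulrBl => /ideal_unitK bK'.
  move/negP: bK; apply; apply: bK' => //.
  by apply: maxideal_1B; apply: idealMl => //; exact: maxideal_ideal.
have mK c : c \in m -> exists n, c ^+ n \in K.
  move=> cm; have [n cn] := colon_exp_stable noethR c idK; exists n.
  apply/negPn/negP => /adjb/adjoinP[r brc].
  have : r * c ^+ n \in K.
    rewrite mulrC; apply: cn; rewrite exprS -mulrA [_ ^+ n * r]mulrC.
    have := idealMl c idK brc; rewrite mulrBr => /(idealB idK (mbK c cm)).
    by rewrite opprB addrC subrK.
  by move/(idealBK idK brc); apply/negP.
have [n mnK] : exists n, {subset ideal_exp m n <= K}.
  apply: contrapT => /forallNP nK.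
  have [P [pP KP mP]] := prime_not_exp noethR idK nK.
  by apply: mP => c /mK[n /KP]; exact: prime_exp.
by move/negP: bK; apply; apply: idealS_sub (bJ n).
Qed.

(* Noetherian induction: if a lies outside K and m a lies in K, passing from a *)
(* chain over K to its sum with (a) loses at most one strict inclusion.        *)
Lemma finite_length J n : is_ideal J -> {subset ideal_exp m n <= J} ->
  exists B, forall N,
    has_chain (fun I => is_ideal I /\ {subset J <= I}) N -> (N <= B)%N.
Proof.
move=> idJ mnJ; apply: contrapT => FJ.
have [K [idK FK JK maxK]] := noetherian_maximal noethR (F := fun J => ~ exists B,
  forall N, has_chain (fun I => is_ideal I /\ {subset J <= I}) N -> (N <= B)%N) idJ FJ.
have {}maxK I : is_ideal I -> {subset K <= I} -> ~ {subset I <= K} ->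
    exists B, forall N,
      has_chain (fun L => is_ideal L /\ {subset I <= L}) N -> (N <= B)%N.
  by move=> idI KI IK; apply: contrapT => FI; apply: IK; exact: maxK.
have [K1|nK1] := boolP (1 \in K).
  apply: FK; exists 0%N => -[//|N] [C [CP Cmono]].
  have [_] := Cmono 0%N isT; case=> x _; have [//|idC KC] := CP 0%N.
  by apply: ideal1 => //; exact: KC.
have [a [aK maK]] : exists a, a \notin K /\ forall c, c \in m -> c * a \in K.
  have mnK : {subset ideal_exp m n <= K} by move=> x /mnJ/JK.
  elim: n mnK {mnJ} => [|k IHk] mnK; first by case/negP: nK1; exact: mnK.
  have [mk|/existsNP[a /not_implyP[amk /negP aK]]] :=
    pselect {subset ideal_exp m k <= K}; first exact: IHk.
  by exists a; split=> // c cm; apply: mnK; exact: ideal_mul_mem.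
have [||B bnd] := maxK (adjoin K a) (adjoin_ideal a idK); first exact: sub_adjoin.
  by move/(_ _ (mem_adjoin a idK)); apply/negP.
apply: FK; exists B.+1 => -[//|N] [C [CP Cmono]]; apply: bnd.
have idC i : (i <= N.+1)%N -> is_ideal (C i) by case/CP.
have KC i : (i <= N.+1)%N -> {subset K <= C i} by case/CP.
(* Once a belongs to the chain, adding (a) changes nothing, so the chain is shifted by one to skip
   the index at which a enters. Before that, strictness survives because m a lies in K. *)
exists (fun i => if a \in C i then C i.+1 else adjoin (C i) a); split=> i iN.
  have [idCi idCi1] := (idC i (leqW iN), idC i.+1 iN).
  case: ifPn => aC; split=> //; last 1 first.
  - apply: adjoin_sub; [exact: adjoin_ideal | | exact: mem_adjoin].
    by move=> x /(KC i (leqW iN)); exact: sub_adjoin.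
  - apply: adjoin_sub => //; first exact: KC.
    by have [+ _] := Cmono i iN; apply.
  - exact: adjoin_ideal.
have [s1 ns1] := Cmono i (ltnW iN); have [s2 ns2] := Cmono i.+1 iN.
have [idCi idCi1] := (idC i (ltnW (leqW iN)), idC i.+1 (leqW iN)).
have [aC|aC] := boolP (a \in C i); first by rewrite s1.
have [aC1|aC1] := boolP (a \in C i.+1).
  have s3 : {subset adjoin (C i) a <= C i.+1} by exact: adjoin_sub.
  by split=> [x /s3/s2//|ss]; apply: ns2 => x /ss/s3.
split; first apply: adjoin_sub; first exact: adjoin_ideal.
- by move=> x /s1; exact: sub_adjoin.
- exact: mem_adjoin.
move=> ss; apply: ns1 => x xC1.
have /ss/adjoinP[r xr] : x \in adjoin (C i.+1) a by exact: sub_adjoin.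
have raC : r * a \in C i.+1.
  by rewrite -[r * a](subKr x) idealB//; exact: s1.
have [rm|/ideal_unitK] := boolP (r \in m); last first.
  by move=> /(_ _ _ idCi1 raC) aC1'; rewrite aC1' in aC1.
apply: (idealBK idCi xr); apply: (KC i (ltnW (leqW iN))); exact: maK.
Qed.

(** * Heights of primes and existence of systems of parameters *)

Fixpoint height_ge k P : Prop :=
  prime_ideal P /\ if k is k'.+1 then
    exists Q, [/\ height_ge k' Q, {subset Q <= P} & ~ {subset P <= Q}] else True.

Lemma height_ge_chain k P : height_ge k P -> has_chain (@prime_ideal R) k.
Proof.
suff : height_ge k P -> exists C : nat -> {pred R}, [/\ C k = P,
    forall i, (i <= k)%N -> prime_ideal (C i) &
    forall i, (i < k)%N -> {subset C i <= C i.+1} /\ ~ {subset C i.+1 <= C i}].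
  by move=> H /H[C [_ C1 C2]]; exists C.
elim: k P => [|k IHk] P.
  by move=> [pP _]; exists (fun=> P); split.
move=> [pP [Q [/IHk[C [CQ C1 C2]] QP nPQ]]].
exists (fun i => if (i <= k)%N then C i else P); split=> [|i ik|i ik].
- by rewrite ltnn.
- by case: ifP => // /C1.
- rewrite -ltnS ik; have [/C2//|ki] := ltnP i k.
  have -> : i = k by apply/eqP; rewrite eqn_leq ki andbT.
  by rewrite CQ.
Qed.

(** One step down: no s outside Q has s z_k^e in (z_0, ..., z_(k-1)), since cancelling z_k would put
    s in Q. Hence [prime_avoiding] gives a prime inside Q over these elements that misses z_k. *)
Lemma height_regular (z : seq R) k Q :
  (forall i, (i < size z)%N -> forall r,
     z`_i * r \in ideal_gen [in take i z] -> r \in ideal_gen [in take i z]) ->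
  (k <= size z)%N -> prime_ideal Q -> {subset ideal_gen [in take k z] <= Q} ->
  height_ge k Q.
Proof.
move=> zreg; elim: k Q => [|k IHk] Q kz pQ zQ; first by split.
split=> //; have [idQ Q1 QM] := pQ.
have zQ' : {subset ideal_gen [in take k z] <= Q}.
  by move=> x xz; apply: zQ; rewrite (take_nth 0 kz); exact: sub_ideal_gen_rcons.
have [||P [pP zP PQ xP]] := @prime_avoiding R noethR Q (ideal_gen [in take k z]) z`_k pQ.
- exact: ideal_gen_ideal.
- move=> s e sQ; apply: contra sQ => sz; apply: zQ'; elim: e sz => [|e IHe].
    by rewrite mulr1.
  by rewrite exprS mulrCA => /(zreg k kz).
exists P; split=> //; first by apply: IHk => //; exact: ltnW.
move=> QP; case/negP: xP; apply: QP; apply: zQ.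
by rewrite (take_nth 0 kz) mem_ideal_gen_rcons.
Qed.

(** Each new element is taken in m outside the finitely many primes that control those over (x),
    except the ones containing m, which no element of m avoids. A nonmaximal prime over the longer
    sequence then strictly contains one of them. *)
Lemma exists_partial_sop i :
  exists x : seq R, [/\ size x = i, {subset x <= m} &
    forall P, prime_ideal P -> ~ {subset m <= P} ->
      {subset ideal_gen [in x] <= P} -> height_ge i P].
Proof.
elim: i => [|i IHi]; first by exists [::]; split.
have [x [szx xm xP]] := IHi.
have [L [L1 L2]] := finite_primes_over noethR (ideal_gen_ideal [in x]).
pose L' := List.filter (fun Q => ~~ `[< {subset m <= Q} >]) L.
have L'P Q : List.In Q L' <-> List.In Q L /\ ~ {subset m <= Q}.
  rewrite List.filter_In; split=> -[LQ].
    by move/asboolPn.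
  by move=> nQ; split=> //; apply/asboolPn.
have [Q /L'P[/L1[pQ _] mQ]|a am aL] := prime_avoidance (L := L') maxideal_ideal.
  by split.
exists (rcons x a); split=> [|y|P pP mP xaP]; first by rewrite size_rcons szx.
  by rewrite mem_rcons inE => /orP[/eqP->|/xm].
have gx : {subset ideal_gen [in x] <= P}.
  by move=> y yx; apply: xaP; exact: sub_ideal_gen_rcons.
split=> //; have [Q LQ QP] := L2 P pP gx; exists Q; split=> //.
  have [pQ xQ] := L1 Q LQ; apply: xP => //.
  by move=> mQ; apply: mP => y /mQ/QP.
move=> PQ; have /negP : a \notin Q.
  by apply: aL; apply/L'P; split=> // mQ; apply: mP => y /mQ/QP.
by apply; apply: PQ; apply: xaP; exact: mem_ideal_gen_rcons.
Qed.

(** A nonmaximal prime over the d elements would have height at least d, giving m height at least d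
    + 1. So every prime over them contains m, and [prime_not_exp] provides a power of m. *)
Lemma exists_sop d : krull_dim R = Fin d -> exists x : d.-tuple R, sop x.
Proof.
move=> dimR; have nht k P : (d < k)%N -> ~ height_ge k P.
  by move=> dk /height_ge_chain/(enat_sup_ub dimR); rewrite leqNgt dk.
have [x [/eqP szx xm xP]] := exists_partial_sop d.
exists (Tuple szx); split=> //; apply: contrapT => /forallNP nx.
have [P [pP gP mP]] := prime_not_exp noethR (ideal_gen_ideal _) nx.
have hP : height_ge d P by apply: xP.
apply: (nht d.+1 m) => //; split; first exact: maxideal_prime.
by exists P; split=> //; exact: prime_sub_maxideal.
Qed.

End Local.

(** * The Koszul complex as an iterated mapping cone *)

Section Koszul.
Variable R : comPzRingType.
Implicit Types (I J : {pred R}).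

Fixpoint koszul (n : nat) : lmodType R :=
  if n is n'.+1 then (koszul n' * koszul n')%type else R^o.

Variable x : nat -> R.

Fixpoint kos_d n : koszul n -> koszul n :=
  if n is n'.+1 then fun u => (kos_d u.1 + x n' *: u.2, - kos_d u.2)
  else fun=> 0.

(* The complex is kept ungraded; [kos_deg i u] says that u lies in degree i,  *)
(* the second summand of each cone being shifted by one.                      *)
Fixpoint kos_deg n : nat -> koszul n -> Prop :=
  if n is n'.+1 then fun i u =>
    kos_deg i u.1 /\ (if i is i'.+1 then kos_deg i' u.2 else u.2 = 0)
  else fun i u => i = 0%N \/ u = 0.

Fixpoint kos_in I n : koszul n -> Prop :=
  if n is n'.+1 then fun u => kos_in I u.1 /\ kos_in I u.2
  else fun u : R => u \in I.

(** Left exterior multiplication by the basis vector e_j, where a pair (u, v) stands for u + e_n' v.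
    The signs in [kos_d] follow the same convention. *)
Fixpoint kos_h j n : koszul n -> koszul n :=
  if n is n'.+1 then fun u =>
    if j == n' then (0, u.1) else (kos_h j u.1, - kos_h j u.2)
  else fun=> 0.

Fixpoint kos_one n : koszul n := if n is n'.+1 then (kos_one n', 0) else 1.

(** The coordinate on the rank-one degree 0 part, whose basis is [kos_one]. *)
Fixpoint kos_aug n : koszul n -> R :=
  if n is n'.+1 then fun u => kos_aug u.1 else fun u => u.

Lemma pair_eq (U V : Type) (u v : U * V) : u.1 = v.1 -> u.2 = v.2 -> u = v.
Proof. by case: u v => [? ?] [? ?] /= -> ->. Qed.

Lemma kos_d_linear n a (u v : koszul n) :
  kos_d (a *: u + v) = a *: kos_d u + kos_d v.
Proof.
elim: n u v => [|n IHn] u v /=; first by rewrite scaler0 addr0.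
apply: pair_eq; rewrite /= !IHn.
  by rewrite !scalerDr !scalerA [a * _]mulrC addrACA.
by rewrite opprD scalerN.
Qed.

Lemma kos_h_linear j n a (u v : koszul n) :
  kos_h j (a *: u + v) = a *: kos_h j u + kos_h j v.
Proof.
elim: n u v => [|n IHn] u v /=; first by rewrite scaler0 addr0.
case: ifP => _; apply: pair_eq; rewrite /= ?IHn ?scaler0 ?addr0 //.
by rewrite opprD scalerN.
Qed.

HB.instance Definition _ n :=
  GRing.isLinear.Build R (koszul n) (koszul n) *:%R (@kos_d n) (@kos_d_linear n).
HB.instance Definition _ j n :=
  GRing.isLinear.Build R (koszul n) (koszul n) *:%R (@kos_h j n) (@kos_h_linear j n).

Lemma kos_dd n (u : koszul n) : kos_d (kos_d u) = 0.
Proof.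
elim: n u => [//|n IHn] u /=; apply: pair_eq => /=.
  by rewrite linearD linearZ /= IHn add0r scalerN subrr.
by rewrite linearN /= IHn !oppr0.
Qed.

Lemma kos_homotopy n j (u : koszul n) : (j < n)%N ->
  kos_d (kos_h j u) + kos_h j (kos_d u) = x j *: u.
Proof.
elim: n u => [//|n IHn] u /=; rewrite ltnS leq_eqVlt.
case: eqP => [->|_] /= jn.
  by apply: pair_eq; rewrite /= ?linear0 ?add0r ?addr0 // addKr.
apply: pair_eq; rewrite /= !(linearD, linearN, linearZ) /= -IHn //.
  by rewrite scalerN addrACA addNr addr0.
by rewrite !opprK.
Qed.

Lemma kos_deg0 n i : kos_deg i (0 : koszul n).
Proof. by elim: n i => [|n IHn] i /=; [right | case: i]. Qed.

Lemma kos_degD n i (u v : koszul n) :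
  kos_deg i u -> kos_deg i v -> kos_deg i (u + v).
Proof.
elim: n i u v => [|n IHn] i u v /=.
  by case=> [->|->]; [left | rewrite add0r].
move=> [u1 u2] [v1 v2]; split; first exact: IHn.
by case: i u2 v2 {u1 v1} => [-> ->|i]; [rewrite addr0 | exact: IHn].
Qed.

Lemma kos_degZ n i a (u : koszul n) : kos_deg i u -> kos_deg i (a *: u).
Proof.
elim: n i u => [|n IHn] i u /=.
  by case=> [->|->]; [left | rewrite scaler0; right].
move=> [u1 u2]; split; first exact: IHn.
by case: i u2 {u1} => [->|i]; [rewrite scaler0 | exact: IHn].
Qed.

Lemma kos_degN n i (u : koszul n) : kos_deg i u -> kos_deg i (- u).
Proof. by rewrite -scaleN1r; exact: kos_degZ. Qed.

Lemma kos_d_deg0 n (u : koszul n) : kos_deg 0 u -> kos_d u = 0.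
Proof.
elim: n u => //= n IHn u [u1 u2].
by rewrite u2 IHn // scaler0 linear0 oppr0 addr0.
Qed.

Lemma kos_d_deg n i (u : koszul n) : kos_deg i.+1 u -> kos_deg i (kos_d u).
Proof.
elim: n i u => [|n IHn] i u /=; first by right.
move=> [u1 u2]; split; first by apply: kos_degD; [exact: IHn | exact: kos_degZ].
case: i u2 {u1} => [|i] u2; last by apply: kos_degN; exact: IHn.
by rewrite kos_d_deg0 ?oppr0.
Qed.

Lemma kos_h_deg n j i (u : koszul n) : kos_deg i u -> kos_deg i.+1 (kos_h j u).
Proof.
elim: n i u => [|n IHn] i u /=; first by right.
move=> [u1 u2]; case: ifP => _ /=; first by split=> //; exact: kos_deg0.
split; first exact: IHn.
case: i u2 {u1} => [->|i u2]; first by rewrite linear0 oppr0; exact: kos_deg0.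
by apply: kos_degN; exact: IHn.
Qed.

Lemma kos_deg_gt n i (u : koszul n) : (n < i)%N -> kos_deg i u -> u = 0.
Proof.
elim: n i u => [|n IHn] [//|i] u /=; first by move=> _ [].
rewrite ltnS => ni [u1 u2]; apply: pair_eq; first exact: (IHn i.+1 _ (ltnW ni)).
exact: (IHn i).
Qed.

Lemma kos_in0 I n : is_ideal I -> kos_in I (0 : koszul n).
Proof. by move=> idI; elim: n => //=; exact: ideal0. Qed.

Lemma kos_inD I n (u v : koszul n) : is_ideal I ->
  kos_in I u -> kos_in I v -> kos_in I (u + v).
Proof.
move=> idI; elim: n u v => [|n IHn] u v /=; first exact: idealD.
by move=> [u1 u2] [v1 v2]; split; exact: IHn.
Qed.

Lemma kos_inZ I n a (u : koszul n) : is_ideal I ->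
  kos_in I u -> kos_in I (a *: u).
Proof.
move=> idI; elim: n u => [|n IHn] u /=; first exact: idealMl.
by move=> [u1 u2]; split; exact: IHn.
Qed.

Lemma kos_inN I n (u : koszul n) : is_ideal I -> kos_in I u -> kos_in I (- u).
Proof. by rewrite -scaleN1r; exact: kos_inZ. Qed.

Lemma kos_in_d I n (u : koszul n) : is_ideal I -> kos_in I u -> kos_in I (kos_d u).
Proof.
move=> idI; elim: n u => [|n IHn] u /=; first by rewrite ideal0.
move=> [u1 u2]; split; last by apply: kos_inN => //; exact: IHn.
by apply: kos_inD; [ | exact: IHn | exact: kos_inZ].
Qed.

Lemma kos_in_h I j n (u : koszul n) : is_ideal I -> kos_in I u -> kos_in I (kos_h j u).
Proof.
move=> idI; elim: n u => [|n IHn] u /=; first by rewrite ideal0.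
move=> [u1 u2]; case: ifP => _ /=; first by split=> //; exact: kos_in0.
by split; [|apply: kos_inN => //]; exact: IHn.
Qed.

Lemma kos_in_cancel I n a (u : koszul n) :
  (forall r, a * r \in I -> r \in I) -> kos_in I (a *: u) -> kos_in I u.
Proof.
move=> areg; elim: n u => [|n IHn] u /=; first exact: areg.
by move=> [u1 u2]; split; exact: IHn.
Qed.

Lemma kos_in_adjoin I a n i (u : koszul n) : is_ideal I -> kos_deg i u ->
  kos_in (adjoin I a) u -> exists2 v, kos_deg i v & kos_in I (u - a *: v).
Proof.
move=> idI; elim: n i u => [|n IHn] i u /=.
  case=> [->|->]; last by exists 0; [right | rewrite scaler0 subrr ideal0].
  by move=> /adjoinP[r ur]; exists r; [left | rewrite [_ *: _]mulrC].
move=> [u1 u2] [/(IHn _ _ u1)[v1 dv1 iv1] iu2].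
case: i u2 {u1 dv1} (dv1) => [|i] u2 dv1.
  exists (v1, 0) => //=; split=> //.
  by rewrite u2 scaler0 subrr; exact: kos_in0.
have [v2 dv2 iv2] := IHn _ _ u2 iu2.
by exists (v1, v2).
Qed.

(* Each x_j acts null-homotopically, so (x) kills the homology. *)
Lemma kos_boundary I n i c (u : koszul n) : is_ideal I ->
  c \in ideal_gen [in mkseq x n] -> kos_deg i u -> kos_in I (kos_d u) ->
  exists2 w, kos_deg i.+1 w & kos_in I (c *: u - kos_d w).
Proof.
move=> idI cx du zu; pose B : {pred R} := [pred c | `[< exists2 w : koszul n,
  kos_deg i.+1 w & kos_in I (c *: u - kos_d w) >]].
suff /asboolP : c \in B by [].
move: c cx; apply: ideal_gen_sub.
  apply: is_idealP => [|b c /asboolP[v dv iv] /asboolP[w dw iw]|b c /asboolP[w dw iw]];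
    apply/asboolP.
  - exists 0; first exact: kos_deg0.
    by rewrite scale0r linear0 subrr; exact: kos_in0.
  - exists (v + w); first exact: kos_degD.
    by rewrite scalerDl linearD /= opprD addrACA; exact: kos_inD.
  - exists (b *: w); first exact: kos_degZ.
    by rewrite linearZ /= -scalerA -scalerBr; exact: kos_inZ.
move=> c cx; have /mapP[j] : c \in mkseq x n := cx.
rewrite mem_iota add0n => /andP[_ jn] ->.
apply/asboolP; exists (kos_h j u); first exact: kos_h_deg.
by rewrite -(kos_homotopy _ jn) addrC addKr; exact: kos_in_h.
Qed.

(* Depth sensitivity of the Koszul complex, by descending induction along the *)
(* regular sequence: z_k is injective on H_i of R/(z_1, ..., z_(k-1)) because  *)
(* H_(i+1) of the next quotient vanishes, and it is nilpotent there.           *)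
Lemma kos_acyclic (z : seq R) n :
  (forall k, (k < size z)%N -> forall r,
     z`_k * r \in ideal_gen [in take k z] -> r \in ideal_gen [in take k z]) ->
  (forall a, a \in z -> exists e, a ^+ e \in ideal_gen [in mkseq x n]) ->
  forall k i (u : koszul n), (k <= size z)%N -> (n + k < i + size z)%N ->
  kos_deg i u -> kos_in (ideal_gen [in take k z]) (kos_d u) ->
  exists2 w, kos_deg i.+1 w & kos_in (ideal_gen [in take k z]) (u - kos_d w).
Proof.
move=> zreg znil k i u /subnK; move: (size z - k)%N => l.
elim: l k i u => [|l IHl] k i u kz nki du zu; set I := ideal_gen _ in zu *.
  have idI : is_ideal I by exact: ideal_gen_ideal.
  rewrite add0n in kz; rewrite -kz ltn_add2r in nki.
  exists 0; first exact: kos_deg0.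
  by rewrite (kos_deg_gt nki du) linear0 subrr; exact: kos_in0.
have idI : is_ideal I by exact: ideal_gen_ideal.
have ltkz : (k < size z)%N by rewrite -kz addSn ltnS leq_addl.
set a := z`_k.
have sub_adj : forall r, r \in ideal_gen [in take k.+1 z] -> r \in adjoin I a.
  by move=> r; rewrite (take_nth 0 ltkz); exact: ideal_gen_rcons.
have kos_sub (J K : {pred R}) p (v : koszul p) :
    {subset J <= K} -> kos_in J v -> kos_in K v.
  move=> JK; elim: p v => [|p IHp] v /=; first exact: JK.
  by move=> [v1 v2]; split; exact: IHp.
have idI1 : is_ideal (ideal_gen [in take k.+1 z]) by exact: ideal_gen_ideal.
have II1 : {subset I <= ideal_gen [in take k.+1 z]}.
  by rewrite (take_nth 0 ltkz); exact: sub_ideal_gen_rcons.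
have aI1 : a \in ideal_gen [in take k.+1 z].
  by rewrite (take_nth 0 ltkz); exact: mem_ideal_gen_rcons.
have kos_in_a p (v : koszul p) : kos_in (ideal_gen [in take k.+1 z]) (a *: v).
  elim: p v => [|p IHp] v /=; last by split; exact: IHp.
  by apply: idealMr.
(* If a v = d b modulo I, then b is a cycle modulo I + (a), so b = d c + a b' modulo I. Applying d
   gives a v = a d b', and a cancels. *)
have inj (v b : koszul n) : kos_deg i v -> kos_deg i.+1 b ->
    kos_in I (a *: v - kos_d b) ->
    exists2 w, kos_deg i.+1 w & kos_in I (v - kos_d w).
  move=> dv db avb.
  have [|||c dc bc] := IHl k.+1 i.+1 b _ _ db.
  - by rewrite -kz addnS addSn.
  - by rewrite addnS addSn ltnS.
  - rewrite -[kos_d b](subKr (a *: v)); apply: kos_inD => //.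
    by apply: kos_inN => //; exact: kos_sub avb.
  have dbc : kos_deg i.+1 (b - kos_d c).
    by apply: kos_degD => //; apply: kos_degN; exact: kos_d_deg.
  have [b' db' bb'] := kos_in_adjoin idI dbc (kos_sub _ _ _ _ sub_adj bc).
  exists b' => //; apply: (@kos_in_cancel _ _ a); first exact: zreg.
  have := kos_in_d idI bb'; rewrite !linearB /= kos_dd subr0 linearZ /=.
  by move=> /(kos_inD idI avb); rewrite addrA subrK -scalerBr.
have [e ae] := znil a (mem_nth 0 ltkz).
have [w dw iw] := kos_boundary idI ae du zu.
(* Some a^e u is a boundary modulo I; [inj] strips one factor a at a time. *)
elim: e w dw iw {ae} => [|e IHe] w dw iw.
  by rewrite scale1r in iw; exists w.
have [||v dv iv] := inj (a ^+ e *: u) w _ dw.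
- exact: kos_degZ.
- by rewrite scalerA -exprS.
exact: IHe iv.
Qed.

Lemma kos_aug_linear n a (u v : koszul n) :
  kos_aug (a *: u + v) = a * kos_aug u + kos_aug v.
Proof. by elim: n u v => //= n IHn u v; rewrite IHn. Qed.

Lemma kos_aug0 n : kos_aug (0 : koszul n) = 0.
Proof. by elim: n. Qed.

Lemma kos_aug_d n (u : koszul n) : kos_aug (kos_d u) \in ideal_gen [in mkseq x n].
Proof.
elim: n u => [|n IHn] u /=; first exact/ideal0/ideal_gen_ideal.
rewrite mkseqS; have idg := ideal_gen_ideal [in rcons (mkseq x n) (x n)].
rewrite addrC kos_aug_linear; apply: idealD => //.
  by apply: idealMr => //; exact: mem_ideal_gen_rcons.
by apply: sub_ideal_gen_rcons; exact: IHn.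
Qed.

Lemma kos_aug_one n : kos_aug (kos_one n) = 1.
Proof. by elim: n. Qed.

Lemma kos_d_one n : kos_d (kos_one n) = 0.
Proof. by elim: n => //= n ->; rewrite scaler0 linear0 oppr0 addr0. Qed.

Lemma kos_deg_one n : kos_deg 0 (kos_one n).
Proof. by elim: n => [|n IHn] /=; [left | split]. Qed.

Lemma kos_in_zero n (u : koszul n) : kos_in (ideal_gen [in [::] : seq R]) u -> u = 0.
Proof.
elim: n u => [|n IHn] u /=; first exact: ideal_gen_nil.
by move=> [u1 u2]; apply: pair_eq; exact: IHn.
Qed.

(** As x_n r kills degree 0 homology, x_n r = d a for some a of degree 1. Then (-a, r) is a 1-cycle
    of the cone, hence a boundary by [kos_acyclic], and its second component shows that r is a
    boundary in degree 0, that is, an element of (x_0, ..., x_(n-1)). *)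
Lemma last_regular (z : seq R) n : size z = n.+1 ->
  (forall k, (k < size z)%N -> forall r,
     z`_k * r \in ideal_gen [in take k z] -> r \in ideal_gen [in take k z]) ->
  (forall a, a \in z -> exists e, a ^+ e \in ideal_gen [in mkseq x n.+1]) ->
  forall r, x n * r \in ideal_gen [in mkseq x n] -> r \in ideal_gen [in mkseq x n].
Proof.
move=> szz zreg znil r xr.
have id0 := ideal_gen_ideal [in [::] : seq R].
have [|a da /kos_in_zero/eqP] := kos_boundary id0 xr (kos_deg_one n).
  by rewrite kos_d_one; exact: kos_in0.
rewrite subr_eq0 => /eqP ea.
pose u : koszul n.+1 := (- a, r *: kos_one n).
have [||||w [_ dw]] := @kos_acyclic z n.+1 zreg znil 0%N 1%N u.
- by [].
- by rewrite szz addn0 add1n.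
- split; first exact: kos_degN.
  exact: kos_degZ (kos_deg_one n).
- rewrite take0; suff -> : kos_d u = 0 by exact: kos_in0.
  apply: pair_eq; rewrite /=.
    by rewrite linearN /= -ea scalerA addNr.
  by rewrite linearZ /= kos_d_one scaler0 oppr0.
rewrite take0 => /kos_in_zero/eqP; rewrite subr_eq0 => /eqP/(congr1 snd)/= er.
have -> : r = kos_aug (r *: kos_one n).
  by rewrite -[_ *: _]addr0 kos_aug_linear kos_aug_one mulr1 kos_aug0 addr0.
by rewrite er -linearN; exact: kos_aug_d.
Qed.

End Koszul.

(** * Ideals, orders and lengths in residue rings *)

Section Residue.
Variables (R : comPzRingType) (S : {pred R}).
Local Notation Q := (residue S).
Implicit Types (I J : {pred R}) (N : {pred Q}).

Lemma residue_pi0 : \pi_Q 0 = 0 :> Q.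
Proof. by apply: (addrI (\pi_Q 0)); rewrite residue_addE !addr0. Qed.

Lemma residue_eq0 a : \pi_Q a = 0 :> Q <-> a \in ideal_gen S.
Proof. by rewrite -residue_pi0 residue_eq subr0. Qed.

Lemma residue_piM a b : \pi_Q a * \pi_Q b = \pi_Q (a * b) :> Q.
Proof. exact: residue_mulE. Qed.

Lemma residue_piZ a b : a *: \pi_Q b = \pi_Q (a * b) :> Q.
Proof. exact: residue_mulE. Qed.

Definition res_preim N : {pred R} := [pred r | \pi_Q r \in N].

(* Only meaningful when I contains S: see [mem_res_im]. *)
Definition res_im I : {pred Q} := [pred u | repr u \in I].

Lemma mem_res_im I a : is_ideal I -> {subset ideal_gen S <= I} ->
  (\pi_Q a \in res_im I) = (a \in I).
Proof.
move=> idI SI; have ra : repr (\pi_Q a) - a \in I.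
  by apply: SI; apply/residue_eq; rewrite reprK.
rewrite inE; apply/idP/idP => [|/(idealBK idI ra)//] raI.
by rewrite -[a](subKr (repr (\pi_Q a))) idealB.
Qed.

Lemma submod_res_preim N : submod_closed N ->
  is_ideal (res_preim N) /\ {subset ideal_gen S <= res_preim N}.
Proof.
move=> [N0 NL]; split; last by move=> a /residue_eq0 a0; rewrite inE a0.
apply: is_idealP => [|u v uN vN|a u uN]; rewrite inE.
- by rewrite residue_pi0.
- by rewrite -residue_addE -[\pi_Q u]scale1r; exact: NL.
- by rewrite -residue_piZ -[_ *: _]addr0; exact: NL.
Qed.

Lemma submod_res_im I : is_ideal I -> {subset ideal_gen S <= I} ->
  submod_closed (res_im I).
Proof.
move=> idI SI; split=> [|a]; first by rewrite -residue_pi0 mem_res_im// ideal0.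
elim/quotW=> u; elim/quotW=> v; rewrite residue_piZ residue_addE !mem_res_im//.
by move=> uI vI; apply: idealD => //; exact: idealMl.
Qed.

Lemma ideal_res_preim N : is_ideal N ->
  is_ideal (res_preim N) /\ {subset ideal_gen S <= res_preim N}.
Proof.
move=> idN; apply: submod_res_preim; split; first exact: ideal0.
by move=> a u v uN vN; apply: idealD => //; exact: idealMl.
Qed.

Lemma ideal_res_im I : is_ideal I -> {subset ideal_gen S <= I} ->
  is_ideal (res_im I).
Proof.
move=> idI SI; have [I0 IL] := submod_res_im idI SI; split=> // a.
by elim/quotW: a => a u v; exact: IL.
Qed.

Lemma pi_maxideal a : a \in maxideal R -> \pi_Q a \in maxideal Q.
Proof.
move=> am; apply/asboolP => N [idN N1 maxN].
have [idpre SP] := ideal_res_preim idN.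
suff : maximal_ideal (res_preim N) by move/asboolP: am => am /am.
split=> // J idJ J1 NJ.
have SJ : {subset ideal_gen S <= J} by move=> x /SP/NJ.
move=> x; rewrite -(mem_res_im _ idJ SJ) (maxN (res_im J)) //.
- exact: ideal_res_im.
- by rewrite (mem_res_im 1 idJ SJ).
- by elim/quotW=> y yN; rewrite mem_res_im//; exact: NJ.
Qed.

Lemma pi_ideal_exp n a : a \in ideal_exp (maxideal R) n ->
  \pi_Q a \in ideal_exp (maxideal Q) n.
Proof.
elim: n a => [//|n IHn] a.
have [idpre SP] := ideal_res_preim (ideal_exp_ideal (maxideal Q) n.+1).
apply: (ideal_mul_sub idpre) => b c bm cm; rewrite inE -residue_piM.
by apply: ideal_mul_mem; [exact: pi_maxideal | exact: IHn].
Qed.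

Hypotheses (noethR : noetherian R) (localR : local_ring R).
Hypothesis Sm : {subset S <= maxideal R}.

Lemma maxideal_residue a : \pi_Q a \in maxideal Q -> a \in maxideal R.
Proof.
have idm := maxideal_ideal localR.
have genm : {subset ideal_gen S <= maxideal R} by exact: ideal_gen_sub.
move/asboolP => am; rewrite -(mem_res_im _ idm genm); apply: am; split.
- exact: ideal_res_im.
- by rewrite (mem_res_im 1 idm genm) maxideal1.
move=> J idJ J1 mJ u; have [idpre SP] := ideal_res_preim idJ.
apply/idP/idP => [|/mJ//]; elim/quotW: u => u uJ.
rewrite mem_res_im//; apply: (sub_maxideal noethR localR idpre) => //.
Qed.

Lemma ideal_exp_residue n a : \pi_Q a \in ideal_exp (maxideal Q) n ->
  a \in idealS (ideal_gen S) (ideal_exp (maxideal R) n).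
Proof.
have idg := ideal_gen_ideal S.
have idS k : is_ideal (idealS (ideal_gen S) (ideal_exp (maxideal R) k)).
  by apply: idealSP => //; exact: ideal_exp_ideal.
have subS k : {subset ideal_gen S <= idealS (ideal_gen S) (ideal_exp (maxideal R) k)}.
  by apply: sub_idealSl; exact: ideal_exp_ideal.
elim: n a => [|n IHn] a; first by move=> _; apply: sub_idealSr.
rewrite -(mem_res_im _ (idS n.+1) (subS n.+1)).
move: (\pi_Q a); apply: ideal_mul_sub; first exact: ideal_res_im.
elim/quotW=> b; elim/quotW=> c /maxideal_residue bm /IHn/asboolP[v vm cv].
rewrite residue_piM mem_res_im//; apply/asboolP; exists (b * v).
  exact: ideal_mul_mem.
by rewrite -mulrBr; exact: idealMl.
Qed.

(** Infinite order would put a in (S) + m^n for all n, against Krull's intersection theorem. *)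
Lemma ord_residue_fin a : a \notin ideal_gen S ->
  exists n, ord (\pi_Q a : Q) = Fin n.
Proof.
move=> aS; have /existsNP[n nan] :
    ~ forall n, a \in idealS (ideal_gen S) (ideal_exp (maxideal R) n).
  move=> H; move/negP: aS; apply; apply: (krull_intersection noethR localR) H.
  exact: ideal_gen_ideal.
apply: (@enat_sup_fin _ n) => k ak; rewrite leqNgt; apply/negP => nk; apply: nan.
by apply: ideal_exp_residue; apply: ideal_exp_anti ak; exact: ltnW.
Qed.

Lemma residue_length_fin n : {subset ideal_exp (maxideal R) n <= ideal_gen S} ->
  exists l, mod_length Q = Fin l.
Proof.
move=> mS; have [B bnd] := finite_length noethR localR (ideal_gen_ideal S) mS.
apply: (@enat_sup_fin _ B) => N [C [CP Cmono]]; apply: bnd.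
exists (fun i => res_preim (C i)); split=> [i iN|i iN].
  exact/submod_res_preim/CP.
have [sC nC] := Cmono i iN; split=> [x xC|ss]; first by rewrite inE sC.
by apply: nC; elim/quotW=> x xC; exact: ss.
Qed.

End Residue.

(** If m^k lies in (S) + m^(k+1), iterating up to the given power n puts m^k in (S). So if m^l is
    not in (S), the ideals (S) + m^k for k = 0, ..., l + 1 are strictly decreasing, a chain longer
    than l. *)
Lemma exp_sub_length (R : comPzRingType) (S : {pred R}) n l :
  {subset ideal_exp (maxideal R) n <= ideal_gen S} ->
  mod_length (residue S) = Fin l ->
  {subset ideal_exp (maxideal R) l <= ideal_gen S}.
Proof.
move=> mS Sl; apply: contrapT => nmlS; set m := maxideal R in mS nmlS.
have idS k : is_ideal (idealS (ideal_gen S) (ideal_exp m k)).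
  by apply: idealSP; [exact: ideal_gen_ideal | exact: ideal_exp_ideal].
have subS k : {subset ideal_gen S <= idealS (ideal_gen S) (ideal_exp m k)}.
  by apply: sub_idealSl; exact: ideal_exp_ideal.
have stop k : (k <= l)%N ->
    ~ {subset ideal_exp m k <= idealS (ideal_gen S) (ideal_exp m k.+1)}.
  move=> kl mk; apply: nmlS => x /(ideal_exp_anti kl) xm.
  have mkj j : {subset ideal_exp m k <= idealS (ideal_gen S) (ideal_exp m (j + k))}.
    elim: j => [|j IHj] y ym; first by apply: sub_idealSr => //; exact: ideal_gen_ideal.
    apply: idealS_sub (IHj y ym) => //.
    apply: ideal_exp_addS => // a b am /mk/asboolP[v vm bv]; apply/asboolP.
    exists (a * v); last first.
      by rewrite -mulrBr; apply: idealMl => //; exact: ideal_gen_ideal.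
    by rewrite addSnnS; exact: ideal_expD.
  apply: (idealS_sub _ _ _ (mkj n x xm)) => //; first exact: ideal_gen_ideal.
  by move=> y /(ideal_exp_anti (leq_addr k n))/mS.
suff : has_chain (fun N : {pred residue S} => submod_closed N) l.+1.
  by move/(enat_sup_ub Sl); rewrite ltnn.
exists (fun i => @res_im R S (idealS (ideal_gen S) (ideal_exp m (l.+1 - i)))); split.
  by move=> i _; exact: submod_res_im.
move=> i il; rewrite subSS subSn //; split=> [|ss].
  elim/quotW=> x; rewrite !mem_res_im//; apply: idealS_sub => // y ym.
  apply: sub_idealSr; first exact: ideal_gen_ideal.
  by move: ym; apply: ideal_exp_anti; exact: leqnSn.
apply: (stop (l - i)%N) => [|x xm]; first exact: leq_subr.
rewrite -(mem_res_im _ (idS _) (subS _)); apply: ss; rewrite mem_res_im//.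
by apply: sub_idealSr => //; exact: ideal_gen_ideal.
Qed.

Lemma regular_sequenceP (R : comPzRingType) (s : seq R) :
  regular_sequence s <-> 1 \notin ideal_gen [in s] /\
  forall i, (i < size s)%N -> forall r,
    s`_i * r \in ideal_gen [in take i s] -> r \in ideal_gen [in take i s].
Proof.
have one_eq0 : (1 : residue [in s]) = 0 <-> 1 \in ideal_gen [in s].
  exact: residue_eq0.
split=> -[s1 sreg]; split.
- by apply: contra s1 => /one_eq0->.
- move=> i si r rs; apply/residue_eq0; apply: (sreg i si).
  by rewrite residue_piZ; apply/residue_eq0.
- by apply: contra s1 => /eqP/one_eq0.
- move=> i si; elim/quotW=> r; rewrite residue_piZ => /residue_eq0/(sreg i si) rs.
  exact/residue_eq0.
Qed.

Definition order_delta (s : 2.-tuple enat) : enat :=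
  match tnth s ord0, tnth s ord_max with
  | Fin a, Fin b => Fin (a + b)
  | _, _ => Inf
  end.

Lemma order_delta_numerical : numerical_function order_delta.
Proof.
have ord2 (i : 'I_2) : (i == ord0) || (i == ord_max) by case: i => [[|[|n]] ni].
rewrite /order_delta; split=> [s|i s t st].
  split; last by move=> [i]; case/orP: (ord2 i) => /eqP-> -> //; case: (tnth s ord0).
  case E0: (tnth s ord0) => [a|]; last by exists ord0.
  by case E1: (tnth s ord_max) => [b|//]; exists ord_max.
case/orP: (ord2 i) => /eqP ei; rewrite {i}ei in st *.
  rewrite (st ord_max) //; case: (tnth t ord_max) => [c|].
    by case: (tnth s _) (tnth t _) => [a|] [b|] //=; rewrite leq_add2r.
  by case: (tnth s _) (tnth t _) => [a|] [b|].
rewrite (st ord0) //; case: (tnth t ord0) => //= c.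
by case: (tnth s _) (tnth t _) => [a|] [b|] //=; rewrite leq_add2l.
Qed.

(** * From Cohen-Macaulay to the order bound *)

Section Main.
Variable R : comPzRingType.
Local Notation m := (maxideal R).

Lemma cohen_macaulay_order_bound d : (0 < d)%N ->
  cohen_macaulay R -> krull_dim R = Fin d -> order_bound R d order_delta.
Proof.
case: d => // d _ [noethR localR depthR] dimR x y [_ xm [n mnx]].
rewrite /order_delta !(tnth_nth Inf) /=.
case El: (mod_length _) => [l|]; last by case: ord.
case Eo: (ord (\pi_(residue _) _)) => [o|]; last by case: ord.
have mlx : {subset ideal_exp m l <= ideal_gen [in tval x]}.
  exact: exp_sub_length mnx El.
rewrite dimR in depthR.
have [z [zm /regular_sequenceP[_ zreg]]] := enat_sup_attained (ltn0Sn d) depthR.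
have xE : mkseq (fun i => x`_i) d.+1 = x.
  by have := mkseq_nth 0 x; rewrite size_tuple.
have xtE : mkseq (fun i => x`_i) d = take d x.
  apply: (@eq_from_nth _ 0) => [|i].
    by rewrite size_mkseq size_take size_tuple ltnSn.
  by rewrite size_mkseq => id; rewrite nth_mkseq // nth_take.
have := @last_regular R (fun i => x`_i) z d (size_tuple z) zreg.
rewrite xE xtE => xreg.
have {}xreg : forall r, x`_d * r \in ideal_gen [in take d x] ->
    r \in ideal_gen [in take d x].
  by apply: xreg => a /zm am; exists n; apply: mnx; exact: ideal_expX.
have idJ := ideal_gen_ideal [in take d x].
apply/enat_sup_le => N sN; rewrite leqNgt; apply/negP => lNo.
have lN : (l <= N)%N by apply: leq_trans (ltnW lNo); exact: leq_addr.
(* K is J + x_d m^(N-l). It contains m^N = m^(N-l) m^l because m^l lies in (x) = J + (x_d). *)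
pose K : {pred R} := [pred w | `[< exists2 v, v \in ideal_exp m (N - l) &
  w - x`_d * v \in ideal_gen [in take d x] >]].
have idK : is_ideal K.
  have idm := ideal_exp_ideal m (N - l).
  apply: is_idealP => [|u w /asboolP[v vm iv] /asboolP[v' vm' iv']|a w /asboolP[v vm iv]];
    apply/asboolP.
  - by exists 0; [exact: ideal0 | rewrite mulr0 subrr ideal0].
  - exists (v + v'); first exact: idealD.
    by rewrite mulrDr opprD addrACA idealD.
  - exists (a * v); first exact: idealMl.
    by rewrite mulrCA -mulrBr idealMl.
have xsplit : (x : seq R) = rcons (take d x) x`_d.
  by rewrite -take_nth ?size_tuple // take_oversize ?size_tuple.
have /asboolP[v vm sv] : \sum_(i < d.+1) x`_i * y`_i \in K.
  move: sN; rewrite -{1}(subnK lN); apply: ideal_exp_addS => // a b am /mlx.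
  rewrite xsplit => /ideal_gen_rcons/adjoinP[r br]; apply/asboolP.
  exists (a * r); first by apply: idealMr => //; exact: ideal_exp_ideal.
  by rewrite mulrCA [x`_d * r]mulrC -mulrBr; apply: idealMl.
have sy : \sum_(i < d.+1) x`_i * y`_i - x`_d * y`_d \in ideal_gen [in take d x].
  rewrite big_ord_recr /= addrK; have := @sum_ideal_gen _ (take d x) (nth 0 y) d.
  rewrite size_take size_tuple ltnSn leqnn => /(_ isT).
  move=> H; rewrite (eq_bigr (fun i : 'I_d => (take d x)`_i * y`_i)) // => i _.
  by rewrite nth_take.
have vy : y`_d - v \in ideal_gen [in take d x].
  apply: xreg; rewrite mulrBr -[x`_d * y`_d](subrK (\sum_(i < d.+1) x`_i * y`_i)).
  rewrite -addrA; apply: idealD => //.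
  by rewrite -opprB; apply: idealN.
have : \pi_(residue [in take d x]) y`_d \in
    ideal_exp (maxideal (residue [in take d x])) (N - l).
  have -> : \pi_(residue [in take d x]) y`_d = \pi_(residue [in take d x]) v.
    exact/residue_eq.
  exact: pi_ideal_exp.
by move/(enat_sup_ub Eo); rewrite leqNgt ltn_subRL lNo.
Qed.

End Main.

(** * From the order bound to Cohen-Macaulay *)

Section Converse.
Variables (R : comPzRingType) (d : nat).
Hypotheses (noethR : noetherian R) (localR : local_ring R).
Hypothesis dimR : krull_dim R = Fin d.+1.
Variable delta : 2.-tuple enat -> enat.
Hypotheses (delta_num : numerical_function delta).
Hypothesis bound : order_bound R d.+1 delta.
Local Notation m := (maxideal R).

(** Write b a as the sum of the x_i c_i and apply the bound to y = (-c, a). The sum vanishes, so its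
    order and hence [delta] are infinite. Yet the length is finite, and so is the order of a if a is
    not in (x). *)
Lemma last_colon (x : seq R) b a : size x = d ->
  {subset rcons x b <= m} ->
  (exists n, {subset ideal_exp m n <= ideal_gen [in rcons x b]}) ->
  b * a \in ideal_gen [in x] -> a \in ideal_gen [in x].
Proof.
move=> szx xm [n mnx] bax; apply/negPn/negP => anx.
have szt : size (rcons x b) == d.+1 by rewrite size_rcons szx.
pose t := Tuple szt.
have sopt : sop t by split=> //; exists n.
have taket : take d.+1.-1 t = x by rewrite /= -szx -cats1 take_size_cat.
have xm' : {subset [in x] <= m}.
  by move=> c cx; apply: xm; rewrite mem_rcons inE orbC (cx : c \in x).
have [o ordo] := ord_residue_fin noethR localR xm' anx.
have [l lenl] : exists l, mod_length (residue [in t]) = Fin l.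
  exact: (residue_length_fin noethR localR mnx).
have [c cE] := ideal_gen_sum bax.
pose y := [tuple if (i < d)%N then - c i else a | i < d.+1].
have yE i (ltid : (i < d.+1)%N) : y`_i = if (i < d)%N then - c i else a.
  by rewrite -(tnth_nth 0 y (Ordinal ltid)) tnth_mktuple.
have := bound y sopt; rewrite taket yE //= ltnn ordo lenl.
suff -> : \sum_(i < d.+1) (rcons x b)`_i * y`_i = 0.
  rewrite [ord 0]enat_sup_inf => [|k]; last exact/ideal0/ideal_exp_ideal.
  case E: (delta _) => [//|] _; have [i] := (delta_num.1 _).1 E.
  by rewrite (tnth_nth Inf); case: i => [[|[|i]] ni].
rewrite big_ord_recr /= nth_rcons szx ltnn eqxx yE // ltnn cE szx -big_split /=.
apply: big1 => i _; rewrite yE; last by rewrite ltnS ltnW.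
by rewrite ltn_ord nth_rcons szx ltn_ord mulrN addNr.
Qed.

Lemma sop_regular (x : d.+1.-tuple R) : sop x -> forall i, (i < d.+1)%N ->
  forall a, x`_i * a \in ideal_gen [in take i x] -> a \in ideal_gen [in take i x].
Proof.
move=> [_ xm [n0 mnx]] i id a xia.
apply: (krull_intersection noethR localR) => [|n]; first exact: ideal_gen_ideal.
(* The entry x_i goes last and the later ones are raised to a power, so that [last_colon] puts a in
   (x_0, ..., x_(i-1)) + m^n. The exponent n + 1 keeps these powers in m even for n = 0. *)
pose w := take i x ++ [seq b ^+ n.+1 | b <- drop i.+1 x].
have idm := maxideal_ideal localR.
have idg := ideal_gen_ideal [in take i x].
have xE : tval x = take i x ++ x`_i :: drop i.+1 x.
  by rewrite -drop_nth ?size_tuple // cat_take_drop.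
have mx b : b \in tval x -> b \in m by move/xm.
have szw : size w = d.
  rewrite size_cat size_map size_drop size_takel size_tuple ?subSS ?subnKC //.
  exact: ltnW.
have wm : {subset rcons w x`_i <= m}.
  move=> b; rewrite mem_rcons inE mem_cat => /or3P[/eqP->|bx|/mapP[c cx ->]].
  - by apply: mx; rewrite mem_nth ?size_tuple.
  - by apply: mx; exact: mem_take bx.
  - by rewrite exprS; apply: idealMr => //; apply: mx; exact: mem_drop cx.
have wprim : exists k, {subset ideal_exp m k <= ideal_gen [in rcons w x`_i]}.
  (* Otherwise some prime over the new sequence does not contain m. But it contains all x_j, hence a
     power of m, hence m. *)
  apply: contrapT => /forallNP nw.
  have [P [pP gP mP]] := prime_not_exp noethR (ideal_gen_ideal _) nw.
  have idP : is_ideal P by case: pP.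
  apply: mP; apply: (prime_ideal_exp (n := n0)) => // b /mnx.
  apply: ideal_gen_sub => // c cx; have {cx}: c \in tval x := cx.
  have inP e : e \in rcons w x`_i -> e \in P.
    by move=> ew; apply: gP; exact: sub_ideal_gen.
  rewrite xE mem_cat inE => /or3P[cx|/eqP->|cx].
  - by apply: inP; rewrite mem_rcons inE mem_cat cx orbT.
  - by apply: inP; rewrite mem_rcons mem_head.
  - apply: (prime_exp (n := n.+1) pP); apply: inP.
    rewrite mem_rcons inE mem_cat; apply/or3P; apply: Or33.
    exact: (map_f (fun b => b ^+ n.+1)).
have /(last_colon szw wm wprim) : x`_i * a \in ideal_gen [in w].
  move: xia; apply: ideal_gen_mono => b bx; have {}bx : b \in take i x := bx.
  have : b \in w by rewrite mem_cat bx.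
  by [].
have idS : is_ideal (idealS (ideal_gen [in take i x]) (ideal_exp m n)).
  by apply: idealSP => //; exact: ideal_exp_ideal.
apply: ideal_gen_sub => // b bw; have {bw}: b \in w := bw.
rewrite mem_cat => /orP[bx|/mapP[c cx ->]].
  by apply: sub_idealSl; [exact: ideal_exp_ideal | exact: sub_ideal_gen].
apply: sub_idealSr => //; apply: (ideal_exp_anti (leqnSn n)).
by apply: ideal_expX; apply: mx; exact: mem_drop cx.
Qed.

Lemma order_bound_cohen_macaulay : cohen_macaulay R.
Proof.
split=> //; rewrite dimR; apply: enat_sup_max => [|n [s [sm /regular_sequenceP[_ sreg]]]].
  have [x sopx] := exists_sop noethR localR dimR; exists x.
  have [_ xm _] := sopx; split=> //; apply/regular_sequenceP; split.
    apply: contra (maxideal1 localR); apply: ideal_gen_sub => //.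
    exact: maxideal_ideal.
  by move=> i; rewrite size_tuple => id a; exact: sop_regular.
apply: (enat_sup_ub dimR); apply: (height_ge_chain (P := m)).
apply: (height_regular noethR (z := s)) => //.
- by rewrite size_tuple.
- exact: maxideal_prime.
- apply: ideal_gen_sub; first exact: maxideal_ideal.
  by move=> b bs; apply: sm; exact: mem_take bs.
Qed.

End Converse.

Theorem theorem12p14 (d : nat) (hd : (1 <= d)%N) :
  (forall R : comPzRingType,
     noetherian R -> local_ring R -> krull_dim R = Fin d ->
     (cohen_macaulay R <->
      exists delta : 2.-tuple enat -> enat,
        numerical_function delta /\ order_bound R d delta)) /\
  (forall e : nat,
     exists delta : 2.-tuple enat -> enat,
       numerical_function delta /\
       forall R : comPzRingType,
         cohen_macaulay R -> krull_dim R = Fin d -> has_multiplicity R e ->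
         order_bound R d delta).
Proof.
split=> [R noethR localR dimR|e]; last first.
  exists order_delta; split; first exact: order_delta_numerical.
  by move=> R cmR dimR _; exact: cohen_macaulay_order_bound.
split=> [cmR|[delta [dnum bound]]].
  exists order_delta; split; first exact: order_delta_numerical.
  exact: cohen_macaulay_order_bound.
case: d hd dimR bound => // d _ dimR bound.
exact: order_bound_cohen_macaulay dnum bound.
Qed.
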